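(* Let $\alpha$ be a Young diagram or a skew diagram, and let $T\in ST(\alpha)$ be a standard tableau of shape $\alpha$. Let $\le_T$ be the partial order on $ST(\alpha)$ defined as the reflexive and transitive closure of the relations $Q\to(i,i+1)Q$ for $Q\in ST(\alpha)$ such that the $i$th tableau swap $(i,i+1)Q$ is in $ST(\alpha)$ and $T(Q^i)<T(Q^{i+1})$. Then the map $m\mapsto T_m$ is a poset isomorphism from the maximal chain descent order $\mathcal Y(\alpha)_{\lambda_T}(2)$ to $(ST(\alpha),\le_T)$.
   Context: Young's lattice $\mathcal Y$ is the set of Young diagrams (integer partitions) ordered by containment. For a Young diagram $\alpha$, $\mathcal Y(\alpha)$ is the interval $[\emptyset,\alpha]$; for a skew diagram $\alpha=\beta/\mu$ (the boxes of $\beta$ not in $\mu$, where $\mu\subseteq\beta$), $\mathcal Y(\alpha)$ denotes the interval $[\mu,\beta]$. Let $n$ be the number of boxes of $\alpha$. A standard tableau of shape $\alpha$ is a bijective filling of the boxes by $[n]=\{1,\dots,n\}$ with entries strictly increasing along rows (left to right) and down columns (top to bottom); $ST(\alpha)$ is the set of these. For a box $b$, $T(b)$ is its entry, and $T^i$ is the box of $T$ with entry $i$. For $1\le i\le n-1$, $(i,i+1)Q$ is the filling obtained from $Q$ by exchanging the entries $i$ and $i+1$; if it is standard it is called the $i$th tableau swap of $Q$. Each cover relation in $\mathcal Y(\alpha)$ adds one box of $\alpha$; for a maximal chain $m$ of $\mathcal Y(\alpha)$, $T_m\in ST(\alpha)$ is the tableau whose box filled with $i$ is the $i$th box added along $m$.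 The labeling $\lambda_T$ of $\mathcal Y(\alpha)$ labels a cover relation which adds the box $b$ by $T(b)$; it is an EL-labeling. For a finite poset $P$ with least element $\hat 0$ and greatest element $\hat 1$, $\mathcal M(P)$ is the set of maximal chains. For a chain $c$ and $x\in c$ write $c^x=\{w\in c: w\le x\}$, $c_x=\{w\in c: w\ge x\}$. A saturated chain gets the sequence of labels of its edges from bottom to top; it is ascending if this sequence is weakly increasing. An EL-labeling is a labeling of cover relations such that for every $x<y$ the interval $[x,y]$ has a unique ascending maximal chain and it lexicographically precedes all other maximal chains of $[x,y]$. A saturated chain $u\lessdot v\lessdot w$ is a descent if $\lambda(u,v)\not\le\lambda(v,w)$. Polygon move: $m\to m'$ if there are $x<z$ in $m\cap m'$ with $m^x=m'^x$, $m_z=m'_z$, such that $m'\cap[x,z]$ is a descent $x\lessdot y\lessdot z$ with $y\notin m$, while $m\cap[x,z]$ is the unique ascending maximal chain of $[x,z]$. The maximal chain descent order $P_\lambda(2)$ is $\mathcal M(P)$ partially ordered by the reflexive and transitive closure of $\to$. *)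

(* Defs.v *)
From Stdlib Require Relation_Definitions Relation_Operators.
From HB Require Import structures.
From mathcomp Require Import all_boot all_order.

Set Implicit Arguments.
Unset Strict Implicit.
Unset Printing Implicit Defensive.

Import Order.TTheory.
Local Open Scope order_scope.

Notation refl_trans_closure := (Relation_Operators.clos_refl_trans _).

(* The isomorphism is required to be between genuine posets, so antisymmetry of
   both relations is part of the notion. *)
Record poset_isomorphism (A B : Type) (leA : A -> A -> Prop)
    (leB : B -> B -> Prop) (f : A -> B) : Prop := PosetIsomorphism {
  iso_dom_order : Relation_Definitions.order A leA;
  iso_cod_order : Relation_Definitions.order B leB;
  iso_bijective : bijective f;
  iso_mono : forall x y, leA x y <-> leB (f x) (f y) }.

Section MaximalChains.

Context {d : Order.disp_t} {P : finTBPOrderType d}.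
Implicit Types (x y z w : P) (c m : {set P}).

Definition covers x y := (x < y) && [forall z, ~~ (x < z < y)].

Definition is_chain c := [forall x in c, forall y in c, x >=< y].

Definition interval_set x y : {set P} := [set w | x <= w <= y].

Definition is_max_chain m := maxset is_chain m.

Definition is_max_chain_of x y c :=
  maxset (fun c' => is_chain c' && (c' \subset interval_set x y)) c.

Definition lower_part c x := [set w in c | w <= x].
Definition upper_part c x := [set w in c | x <= w].

(* Values of [f] on the pairs of consecutive elements of the chain [c], from
   bottom to top. *)
Definition along (A : Type) (f : P -> P -> A) c : seq A :=
  if sort <=%O (enum c) is x :: s then pairmap f x s else [::].

End MaximalChains.

Record max_chain {d : Order.disp_t} (P : finTBPOrderType d) := MaxChain {
  chain_set :> {set P};
  max_chainP : is_max_chain chain_set }.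

Section ChainDescentOrder.

Context {d dL : Order.disp_t} {P : finTBPOrderType d} {L : porderType dL}.

(* An edge labeling is a total function of two elements; only its values on
   cover relations are ever used. *)
Variable lab : P -> P -> L.
Implicit Types (x y z : P) (c : {set P}) (m : max_chain P).

Definition ascending c := sorted <=%O (along lab c).

Definition unique_ascending x z c :=
  [/\ is_max_chain_of x z c, ascending c &
      forall c', is_max_chain_of x z c' -> ascending c' -> c' = c].

Definition descent x y z :=
  [&& covers x y, covers y z & ~~ (lab x y <= lab y z)].

Definition polygon_move m m' : Prop :=
  exists x z,
    [/\ x < z, x \in m :&: m' & z \in m :&: m'] /\
    lower_part m x = lower_part m' x /\
    upper_part m z = upper_part m' z /\
    (exists y, [/\ m' :&: interval_set x z = [set x; y; z],
                   descent x y z & y \notin m]) /\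
    unique_ascending x z (m :&: interval_set x z).

Definition chain_descent_le : max_chain P -> max_chain P -> Prop :=
  refl_trans_closure polygon_move.

End ChainDescentOrder.

Definition is_partition (s : seq nat) := sorted geq s && (0%N \notin s).

(* Young diagrams in English notation: row [i] has [nth 0 rows i] boxes. *)
Record young := Young { rows :> seq nat; _ : is_partition rows }.
HB.instance Definition _ := [isSub for rows].
HB.instance Definition _ := [Choice of young by <:].

Definition boxes (nu : young) : seq (nat * nat) :=
  [seq (i, j) | i <- iota 0 (size nu), j <- iota 0 (nth 0%N nu i)].

Lemma mem_boxes (nu : young) i j : ((i, j) \in boxes nu) = (j < nth 0 nu i)%N.
Proof.
apply/allpairsPdep/idP => [[i' [j' [_ + [-> ->]]]]|lt_j].
  by rewrite mem_iota.
exists i, j; rewrite !mem_iota /= add0n; split=> //.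
by case: (ltnP i) => // le_i; rewrite nth_default in lt_j.
Qed.

Definition young_le (mu nu : young) := all [in boxes nu] (boxes mu).

Lemma young_leP (mu nu : young) :
  reflect (forall i, nth 0 mu i <= nth 0 nu i)%N (young_le mu nu).
Proof.
apply: (iffP allP) => [sub i | le_rows [i j]].
  case def_k: (nth 0%N mu i) => [//|k].
  by have:= sub (i, k); rewrite /= !mem_boxes def_k; apply.
by rewrite /= !mem_boxes => lt_j; apply: leq_trans (le_rows i).
Qed.

Lemma young_pos (nu : young) i : (i < size nu)%N -> (0 < nth 0 nu i)%N.
Proof.
case: nu => s /= /andP[_ s0] lt_i; rewrite lt0n; apply: contra s0 => /eqP <-.
exact: mem_nth.
Qed.

Lemma young_le_size (mu nu : young) : young_le mu nu -> (size mu <= size nu)%N.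
Proof.
move/young_leP=> le_rows; rewrite leqNgt; apply/negP => /young_pos.
by move/leq_trans/(_ (le_rows _)); rewrite nth_default.
Qed.

Fact young_display : Order.disp_t. Proof. exact: Order.Disp tt tt. Qed.

Lemma young_le_refl : reflexive young_le.
Proof. by move=> nu; apply/young_leP. Qed.

Lemma young_le_anti : antisymmetric young_le.
Proof.
move=> mu nu /andP[le1 le2]; apply: val_inj; apply: (@eq_from_nth _ 0%N).
  by apply/eqP; rewrite eqn_leq !young_le_size.
move=> i _; apply/eqP.
by rewrite eqn_leq (young_leP _ _ le1 i) (young_leP _ _ le2 i).
Qed.

Lemma young_le_trans : transitive young_le.
Proof.
move=> nu mu pi /young_leP le1 /young_leP le2; apply/young_leP => i.
exact: leq_trans (le1 i) (le2 i).
Qed.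

HB.instance Definition _ := Order.Le_isPOrder.Build young_display young
  young_le_refl young_le_anti young_le_trans.

Record skew_diagram := Skew {
  outer : young;
  inner : young;
  inner_le_outer : inner <= outer }.

Definition empty_young : young := @Young [::] isT.

Lemma empty_young_le nu : empty_young <= nu. Proof. by []. Qed.

(* A Young diagram is the skew diagram whose inner diagram is empty. *)
Coercion skew_of_young (nu : young) : skew_diagram := Skew (empty_young_le nu).

Definition skew_boxes (alpha : skew_diagram) :=
  [seq b <- boxes (outer alpha) | b \notin boxes (inner alpha)].

Notation box alpha := (seq_sub (skew_boxes alpha)).

(* The interval [inner alpha, outer alpha] of Young's lattice. *)
Record young_interval (alpha : skew_diagram) := YoungInterval {
  diagram :> young;
  diagramP : inner alpha <= diagram <= outer alpha }.

Section YoungIntervalPoset.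

Variable alpha : skew_diagram.
Local Notation Y := (young_interval alpha).

HB.instance Definition _ := [isSub of Y for @diagram alpha].
HB.instance Definition _ := [Choice of Y by <:].

Let N := size (outer alpha).
Let M := head 0%N (outer alpha).

Definition interval_code (nu : Y) : {ffun 'I_N -> 'I_M.+1} :=
  [ffun i : 'I_N => inord (nth 0%N nu i)].

Definition interval_decode (f : {ffun 'I_N -> 'I_M.+1}) : option Y :=
  obind insub (insub [seq k <- [seq val k | k <- codom f] | 0 < k]%N).

Lemma interval_codeK : pcancel interval_code interval_decode.
Proof.
move=> nu; rewrite /interval_decode; have [_ le_nu] := andP (diagramP nu).
suff ->: [seq k <- [seq val k | k <- codom (interval_code nu)] | (0 < k)%N]
         = rows nu by rewrite (valK (diagram nu)) /= (valK nu).
have bnd i : (nth 0 nu i <= M)%N.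
  apply: leq_trans (young_leP _ _ le_nu i) _; rewrite /M.
  case: (outer alpha) => -[|a s] /= /andP[]; first by rewrite nth_nil.
  case: i => //= i; rewrite path_sortedE => [/andP[/allP geq_s _] _|x y z].
    by case: (ltnP i (size s)) => [/(mem_nth 0%N)/geq_s // | /(nth_default _)->].
  by move=> xy yz; apply: leq_trans yz xy.
have ->: [seq val k | k <- codom (interval_code nu)] = mkseq (nth 0%N nu) N.
  rewrite codomE -map_comp /mkseq -val_enum_ord -map_comp.
  by apply: eq_map => i /=; rewrite ffunE inordK // ltnS.
rewrite /mkseq /N -(subnKC (young_le_size le_nu)) iotaD map_cat filter_cat.
rewrite -/(mkseq _ _) mkseq_nth add0n (_ : filter _ (map _ _) = [::]).
  rewrite cats0; apply/all_filterP/allP => k /(nthP 0%N)[i lt_i <-].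
  exact: young_pos.
rewrite filter_map (_ : filter _ _ = [::]) //; apply/eqP.
rewrite -[_ == _]negbK -has_filter; apply/hasPn => i.
by rewrite mem_iota => /andP[le_i _] /=; rewrite nth_default.
Qed.

HB.instance Definition _ := PCanIsCountable interval_codeK.
HB.instance Definition _ : isFinite Y := PCanIsFinite interval_codeK.
HB.instance Definition _ := [SubChoice_isSubPOrder of Y by <: with young_display].

Fact inner_in_interval : inner alpha <= inner alpha <= outer alpha.
Proof. by rewrite lexx inner_le_outer. Qed.

Fact outer_in_interval : inner alpha <= outer alpha <= outer alpha.
Proof. by rewrite lexx inner_le_outer. Qed.

Fact interval_bottomP (nu : Y) : YoungInterval inner_in_interval <= nu.
Proof. by case: nu => nu /[dup] /andP[]. Qed.

Fact interval_topP (nu : Y) : nu <= YoungInterval outer_in_interval.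
Proof. by case: nu => nu /[dup] /andP[]. Qed.

HB.instance Definition _ :=
  Order.hasBottom.Build young_display Y interval_bottomP.
HB.instance Definition _ := Order.hasTop.Build young_display Y interval_topP.

End YoungIntervalPoset.

Section StandardTableaux.

Variable alpha : skew_diagram.
Local Notation filling := {ffun box alpha -> nat}.

Definition is_standard (T : filling) :=
  [&& perm_eq (codom T) (iota 1 #|{: box alpha}|),
      [forall b : box alpha, forall c : box alpha,
        ((val b).1 == (val c).1) && ((val b).2 < (val c).2)%N
          ==> (T b < T c)%N] &
      [forall b : box alpha, forall c : box alpha,
        ((val b).2 == (val c).2) && ((val b).1 < (val c).1)%N
          ==> (T b < T c)%N]].

Record std_tableau := StdTableau {
  entry :> filling;
  entryP : is_standard entry }.

Definition swap_entries (i : nat) (Q : filling) : filling :=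
  [ffun b => [fun k => k with i |-> i.+1, i.+1 |-> i] (Q b)].

(* [Q b = i] says that [b] is the box of [Q] with entry [i]. *)
Definition swap_step (T Q Q' : std_tableau) : Prop :=
  exists (i : nat) (b c : box alpha),
    [/\ (1 <= i < #|{: box alpha}|)%N, Q b = i, Q c = i.+1,
        (T b < T c)%N & entry Q' = swap_entries i Q].

Definition tableau_le (T : std_tableau) : std_tableau -> std_tableau -> Prop :=
  refl_trans_closure (swap_step T).

Definition added_box (u v : young_interval alpha) : option (box alpha) :=
  [pick b | (val b \in boxes v) && (val b \notin boxes u)].

Definition tableau_labeling (T : std_tableau) (u v : young_interval alpha) : nat :=
  oapp T 0%N (added_box u v).

(* [index] is 0-based, so the i-th box added along [m] is filled with [i]. *)
Definition chain_tableau (m : max_chain (young_interval alpha)) : filling :=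
  [ffun b => (index (Some b) (along added_box m)).+1].

End StandardTableaux.

(* Main.v *)
Require Import Defs.
From Stdlib Require Import Relation_Operators.
From mathcomp Require Import all_boot all_order.
From mathcomp Require Import zify.

Set Implicit Arguments.
Unset Strict Implicit.
Unset Printing Implicit Defensive.

Import Order.TTheory.
Local Open Scope order_scope.

(** An element [u] of the interval [Y] is determined by the set [region u] of the
boxes of [alpha] that it contains, and the order of [Y] is inclusion of regions.
The regions are closed under going left or up inside [alpha].  If [u < v], then
some single box of [v] can be added to [u], so [v] covers [u] exactly when
[region v] is [region u] with one more box ([coversP]).

A standard tableau [Q] therefore gives a maximal chain, formed by the elements
whose regions are the sets [sublevel Q k] of boxes with entry at most [k]
([tableau_chain_max]); reading off the boxes added along it returns [Q]
([tableau_chainK]).  Conversely a maximal chain meets every rank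
([max_chain_rank]), and filling each box with the rank of the first element of
the chain that contains it is a standard tableau whose chain is the given one
([max_chain_tableau]).  So maximal chains and standard tableaux are in bijection,
and this dictionary turns statements on chains into statements on sublevel sets.

A polygon move changes a chain at one rank [i] only, so the two tableaux have the
same sublevel sets except at [i], and they differ by the exchange of [i] and
[i.+1] ([sublevel_swap]); the descent condition on labels says which of the two
boxes has the smaller entry in [T].  Conversely, if [b] and [c] carry [i] and
[i.+1] and both orders of adding them are allowed, then the interval between the
elements of ranks [i.-1] and [i.+1] is a square, which has exactly two maximal
chains, with labels [T b, T c] and [T c, T b]; this is a polygon move
([square_polygon_move]).  Hence the bijection matches the generating relations,
and so their closures.  Both closures are antisymmetric because a swap step
strictly decreases the sum of [T b * Q b] over all boxes [b]. *)

(** * Maximal chains in finite posets *)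

Section Chains.

Context {d : Order.disp_t} {P : finTBPOrderType d}.
Implicit Types (x y z u : P) (c m : {set P}).

Lemma chain_comparable c x y : is_chain c -> x \in c -> y \in c -> x >=< y.
Proof. by move/'forall_in_'forall_in_idP => + cx cy; move/(_ x cx y cy). Qed.

Lemma max_chain_chain m : is_max_chain m -> is_chain m.
Proof. by case/maxsetP. Qed.

Lemma max_chain_closed m u :
  is_max_chain m -> {in m, forall w, u >=< w} -> u \in m.
Proof.
case/maxsetP=> chm maxm cmp; rewrite -(maxm (u |: m)) ?setU11 ?subsetUr //.
apply/'forall_in_'forall_in_idP => x /setU1P[->|mx] y /setU1P[->|my].
- exact: comparablexx.
- exact: cmp.
- by rewrite comparable_sym cmp.
- exact: (chain_comparable chm).
Qed.

(** Anything comparable with a part of [m] inside [[x, z]] and lying in [[x, z]] is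
comparable with all of [m], since [x] and [z] belong to [m]. *)
Lemma max_chain_interval m x z : is_max_chain m -> x \in m -> z \in m ->
  is_max_chain_of x z (m :&: interval_set x z).
Proof.
move=> maxm mx mz; have chm := max_chain_chain maxm.
apply/maxsetP; split=> [|c /andP[chc /subsetP c_xz] /subsetP sub_c].
  rewrite subsetIr andbT; apply/'forall_in_'forall_in_idP => u /setIP[mu _].
  move=> v /setIP[mv _].
  exact: (chain_comparable chm).
apply/eqP; rewrite eqEsubset; apply/andP; split; last exact/subsetP.
apply/subsetP=> u cu; have xzu := c_xz u cu; rewrite inE xzu andbT.
move: xzu; rewrite inE => /andP[xu uz].
apply: (max_chain_closed maxm) => w mw.
have [wx|xw] := orP (chain_comparable chm mw mx).
  by rewrite /Order.comparable (le_trans wx xu) orbT.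
have [wz|zw] := orP (chain_comparable chm mw mz); last first.
  by rewrite /Order.comparable (le_trans uz zw).
by apply: (chain_comparable chc) => //; apply: sub_c; rewrite !inE mw xw.
Qed.

Lemma lower_part_eq c c' x :
  (forall u, u <= x -> (u \in c) = (u \in c')) -> lower_part c x = lower_part c' x.
Proof.
move=> eq_c; apply/setP=> u; rewrite !inE; case le_u: (u <= x); rewrite ?andbF //.
by rewrite eq_c.
Qed.

Lemma upper_part_eq c c' x :
  (forall u, x <= u -> (u \in c) = (u \in c')) -> upper_part c x = upper_part c' x.
Proof.
move=> eq_c; apply/setP=> u; rewrite !inE; case le_u: (x <= u); rewrite ?andbF //.
by rewrite eq_c.
Qed.

Lemma mem_lower_part c x u : (u \in lower_part c x) = (u \in c) && (u <= x).
Proof. by rewrite inE. Qed.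

Lemma mem_upper_part c x u : (u \in upper_part c x) = (u \in c) && (x <= u).
Proof. by rewrite inE. Qed.

(** Enumerates a chain without sorting: any strictly increasing listing will do. *)
Lemma alongE (A : Type) (f : P -> P -> A) c x s :
  path <%O x s -> c =i x :: s -> along f c = pairmap f x s.
Proof.
move=> lt_s def_c; rewrite /along.
suff ->: sort <=%O (enum c) = x :: s by [].
have le_s : sorted <=%O (x :: s) by apply: sub_path lt_s => a b /ltW.
have uniq_s : uniq (x :: s).
  by apply: (sorted_uniq lt_trans ltxx).
have perm_c : perm_eq (enum c) (x :: s).
  by apply: uniq_perm; rewrite ?enum_uniq // => u; rewrite mem_enum def_c.
have tot : {in c &, total <=%O}.
  move: le_s; rewrite (sorted_pairwise le_trans) => /(pairwiseP x) pw u v.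
  rewrite !def_c => su sv.
  have [lt_uv|lt_vu|eq_uv] := ltngtP (index u (x :: s)) (index v (x :: s)).
  - by have:= pw _ _ _ _ lt_uv; rewrite !inE !index_mem !nth_index // => ->.
  - by have:= pw _ _ _ _ lt_vu; rewrite !inE !index_mem !nth_index // orbC => ->.
  - by rewrite -(nth_index x su) eq_uv nth_index ?lexx.
apply: (sorted_eq le_trans le_anti) => //; last by rewrite perm_sort.
by apply: (sort_sorted_in tot); apply/allP => u; rewrite mem_enum.
Qed.

End Chains.

(** * Regions of the elements of an interval of Young's lattice *)

Section Regions.

Variable alpha : skew_diagram.
Local Notation Y := (young_interval alpha).
Local Notation B := (box alpha).
Implicit Types (u v w : Y) (b c e : B).

(** [c] is left of [b] in its row or above [b] in its column: the comparisons that
standardness is about. *)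
Definition before c b :=
  ((val c).1 == (val b).1) && ((val c).2 < (val b).2)%N ||
  ((val c).2 == (val b).2) && ((val c).1 < (val b).1)%N.

Lemma before_lt c b :
  before c b -> ((val c).1 + (val c).2 < (val b).1 + (val b).2)%N.
Proof. by case/orP=> /andP[/eqP-> lt]; rewrite ?ltn_add2l ?ltn_add2r. Qed.

Definition region u : {set B} := [set b | val b \in boxes u].

Lemma young_antitone (nu : young) i j :
  (i <= j)%N -> (nth 0 nu j <= nth 0 nu i)%N.
Proof.
case: nu => s /= /andP[sorted_s _] le_ij.
have [lt_j|/(nth_default 0%N)->//] := ltnP j (size s).
have geq_trans : transitive geq by move=> x y z xy yz; apply: leq_trans yz xy.
apply: (sorted_leq_nth geq_trans leqnn 0%N sorted_s) => //.
by rewrite inE (leq_ltn_trans le_ij).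
Qed.

Lemma mem_skew_boxes i j : ((i, j) \in skew_boxes alpha) =
  (nth 0 (inner alpha) i <= j < nth 0 (outer alpha) i)%N.
Proof. by rewrite mem_filter !mem_boxes -leqNgt. Qed.

(** A box of [u] outside [alpha] lies in the inner diagram, hence in [v] as well. *)
Lemma region_le u v : (u <= v) = (region u \subset region v).
Proof.
have [/young_leP inner_v _] := andP (diagramP v).
have [_ /young_leP u_outer] := andP (diagramP u).
have ->: (u <= v) = young_le u v by [].
apply/allP/subsetP=> [sub b | sub [i j]]; first by rewrite !inE => /sub.
rewrite /= !mem_boxes => u_ij.
have [/leq_trans->//|in_j] := ltnP j (nth 0%N (inner alpha) i).
have b_in : (i, j) \in skew_boxes alpha.
  by rewrite mem_skew_boxes in_j (leq_trans u_ij).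
by have:= sub (SeqSub b_in); rewrite !inE !mem_boxes; apply.
Qed.

Lemma region_inj : injective region.
Proof. by move=> u v eq_uv; apply: le_anti; rewrite !region_le eq_uv subxx. Qed.

Lemma region_lt u v : (u < v) = (region u \proper region v).
Proof. by rewrite lt_def properEneq region_le (inj_eq region_inj) eq_sym. Qed.

Lemma region_before u b c : before c b -> b \in region u -> c \in region u.
Proof.
rewrite /before !inE; case: b c => -[i j] b_in [[i' j'] c_in] /=.
rewrite !mem_boxes.
case/orP=> /andP[/eqP-> lt]; first exact: ltn_trans.
by move/leq_trans; apply; apply: young_antitone; apply: ltnW.
Qed.

Lemma region_bottom : region \bot = set0.
Proof.
apply/setP=> b; rewrite !inE; apply/negbTE.
by have:= valP b; rewrite mem_filter => /andP[].
Qed.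

Lemma region_top : region \top = setT.
Proof.
by apply/setP=> b; rewrite !inE; have:= valP b; rewrite mem_filter => /andP[].
Qed.

(** Only row [i] of [u] needs to grow, where [(i, j)] is the box [b]: the boxes left
of [b] force row [i] to have length exactly [j], and those above [b] force the
previous rows to be longer than [j], so that lengthening row [i] by one leaves a
partition. *)
Lemma region_add u b : b \notin region u ->
  (forall c, before c b -> c \in region u) ->
  exists v, region v = b |: region u.
Proof.
have [/young_leP inner_u /young_leP u_outer] := andP (diagramP u).
case: b => -[i j] b_in; rewrite inE mem_boxes /= -leqNgt => u_ij prev.
have := b_in; rewrite mem_skew_boxes => /andP[in_j j_out].
have row_u : nth 0%N u i = j.
  apply/eqP; rewrite eqn_leq u_ij leqNgt; apply/negP=> lt_j.
  have c_in : (i, nth 0%N u i) \in skew_boxes alpha.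
    by rewrite mem_skew_boxes inner_u (ltn_trans lt_j).
  have := prev (SeqSub c_in); rewrite inE mem_boxes /= ltnn.
  by rewrite /before /= eqxx lt_j => /(_ isT).
have col_u k : (k < i)%N -> (j < nth 0 u k)%N.
  move=> lt_k; rewrite ltnNge; apply/negP => le_j.
  have c_in : (k, j) \in skew_boxes alpha.
    rewrite mem_skew_boxes (leq_trans (inner_u k)) //=.
    by apply: leq_trans j_out _; apply: young_antitone; apply: ltnW.
  have := prev (SeqSub c_in); rewrite inE mem_boxes /= ltnNge le_j.
  by rewrite /before /= eqxx lt_k orbT => /(_ isT).
have i_size : (i <= size u)%N.
  case: i {b_in row_u prev in_j j_out u_ij} col_u => // i col_u.
  rewrite ltnNge; apply/negP=> /(nth_default 0%N) u0.
  by have:= col_u i; rewrite u0 => /(_ (leqnn _)).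
have part : is_partition (incr_nth u i).
  apply/andP; split.
    apply/(sortedP 0%N) => k _; rewrite /= !nth_incr_nth.
    have le_k := young_antitone u (leqnSn k).
    case: (eqVneq i k.+1) => [def_i|_].
      by have:= col_u k; rewrite -def_i row_u gtn_eqF def_i //; apply.
    exact: leq_trans le_k (leq_addl _ _).
  apply/(nthP 0%N) => -[k lt_k]; rewrite nth_incr_nth => /eqP.
  rewrite addn_eq0 eqb0 => /andP[i_k /eqP u_k].
  have: (k < size u)%N.
    move: lt_k; rewrite size_incr_nth; case: ifP => // _; rewrite ltnS leq_eqVlt.
    by rewrite eq_sym (negbTE i_k) => /leq_trans; apply.
  by move/young_pos; rewrite u_k.
have vP : inner alpha <= Young part <= outer alpha.
  apply/andP; split; apply/young_leP=> k /=; rewrite nth_incr_nth.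
    exact: leq_trans (inner_u k) (leq_addl _ _).
  by case: eqVneq => [<-|_]; rewrite ?add0n ?u_outer // row_u.
exists (YoungInterval vP); apply/setP=> -[[k l] c_in].
rewrite !inE !mem_boxes /= nth_incr_nth -(inj_eq val_inj) /= xpair_eqE.
by case: (eqVneq i k) => [<-|nik]; rewrite ?row_u; lia.
Qed.

(** Add to [u] a box of [v] of least coordinate sum: all boxes before it are in [u]. *)
Lemma region_step u v : u < v ->
  exists w b, [/\ b \notin region u, region w = b |: region u & w <= v].
Proof.
rewrite region_lt => /properP[/subsetP sub_uv [b0 vb0 ub0]].
have ex0 : (b0 \in region v) && (b0 \notin region u) by rewrite vb0.
case: (@arg_minnP _ b0 (fun b => (b \in region v) && (b \notin region u))
  (fun b => (val b).1 + (val b).2)%N ex0) => b /andP[vb ub] min_b.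
have [c lt_cb|w def_w] := region_add ub.
  apply/negPn/negP=> uc; have := min_b c; rewrite uc (region_before lt_cb vb).
  by move/(_ isT); rewrite leqNgt before_lt.
exists w, b; split=> //; rewrite region_le def_w subUset sub1set vb.
exact/subsetP.
Qed.

Lemma coversP u v :
  reflect (exists2 b, b \notin region u & region v = b |: region u) (covers u v).
Proof.
apply: (iffP andP) => [[lt_uv /forallP no_w] | [b ub def_v]].
  have [w [b [ub def_w le_wv]]] := region_step lt_uv; exists b => //.
  have lt_uw : u < w.
    by rewrite region_lt def_w properE subsetUr subUset sub1set (negbTE ub).
  by have:= no_w w; rewrite lt_uw lt_neqAle le_wv andbT negbK => /eqP <-.
split; first by rewrite region_lt def_v properE subsetUr subUset sub1set (negbTE ub).
apply/forallP=> w; apply/negP; rewrite !region_lt => /andP[uw wv].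
have := proper_card uw; have:= proper_card wv; rewrite def_v cardsU1 ub; lia.
Qed.

Lemma added_boxE u v b :
  b \notin region u -> region v = b |: region u -> added_box u v = Some b.
Proof.
move=> ub def_v; rewrite /added_box.
have in_diff c : (val c \in boxes v) && (val c \notin boxes u) = (c == b).
  have:= congr1 (fun s : {set B} => c \in s) def_v; rewrite !inE => ->.
  move: ub; rewrite inE; case: eqVneq => [->|_] /= ub; first by rewrite ub.
  by rewrite andbN.
case: pickP => [c|/(_ b)]; first by rewrite in_diff => /eqP->.
by rewrite in_diff eqxx.
Qed.

Lemma rank_inj u v : u >=< v -> #|region u| = #|region v| -> u = v.
Proof.
move=> cmp eq_rank; apply: region_inj; apply/eqP.
case/orP: cmp; rewrite region_le => sub; last rewrite eq_sym.
  by rewrite eqEcard sub eq_rank leqnn.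
by rewrite eqEcard sub eq_rank leqnn.
Qed.

Lemma rank_le u v : u >=< v -> (#|region u| <= #|region v|)%N -> u <= v.
Proof.
case/orP=> // le_vu le_rank; rewrite (@rank_inj u v) ?lexx //.
  by rewrite /Order.comparable le_vu orbT.
by apply/eqP; rewrite eqn_leq le_rank subset_leq_card // -region_le.
Qed.

(** If the chain jumped over rank [k.+1], an element covering its member of rank [k]
could be inserted. *)
Lemma max_chain_rank (m : {set Y}) k : is_max_chain m -> (k <= #|{: B}|)%N ->
  exists2 u, u \in m & #|region u| = k.
Proof.
move=> maxm; have chm := max_chain_chain maxm.
elim: k => [_|k IHk lt_k].
  exists \bot; last by rewrite region_bottom cards0.
  by apply: (max_chain_closed maxm) => w _; rewrite /Order.comparable le0x.
have [u mu rank_u] := IHk (ltnW lt_k).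
have mtop : \top \in m.
  by apply: (max_chain_closed maxm) => w _; rewrite /Order.comparable lex1 orbT.
have ex0 : (\top \in m) && (u < \top).
  rewrite mtop region_lt region_top properEcard subsetT rank_u.
  by rewrite cardsT.
(* The next member [v] of the chain after [u]. *)
case: (@arg_minnP _ \top (fun v => (v \in m) && (u < v))
  (fun v => #|region v|) ex0) => v /andP[mv lt_uv] min_v.
have [w [b [ub def_w le_wv]]] := region_step lt_uv.
exists w; last by rewrite def_w cardsU1 ub rank_u.
have le_uw : u <= w by rewrite region_le def_w subsetUr.
apply: (max_chain_closed maxm) => x mx.
have [xu|ux] := orP (chain_comparable chm mx mu).
  by rewrite /Order.comparable (le_trans xu le_uw) orbT.
move: ux; rewrite le_eqVlt => /orP[/eqP<-|ux].
  by rewrite /Order.comparable le_uw orbT.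
have le_vx : v <= x.
  by apply: rank_le; rewrite ?(chain_comparable chm) ?min_v ?mx.
by rewrite /Order.comparable (le_trans le_wv le_vx).
Qed.



(** * From standard tableaux to maximal chains *)

Definition sublevel (Q : {ffun B -> nat}) k : {set B} := [set b | (Q b <= k)%N].

Lemma standardP (Q : {ffun B -> nat}) : reflect
  [/\ injective Q, forall b, (0 < Q b <= #|{: B}|)%N
    & forall b c, before b c -> (Q b < Q c)%N] (is_standard Q).
Proof.
apply: (iffP and3P) => [[permQ /'forall_forallP rows_lt /'forall_forallP cols_lt]|].
  have permE := perm_mem permQ; split=> [|b|b c].
  - apply/injectiveP; rewrite /injectiveb /dinjectiveb -codomE.
    by rewrite (perm_uniq permQ) iota_uniq.
  - by have:= permE (Q b); rewrite codom_f mem_iota add1n ltnS => <-.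
  - case/orP=> lt_bc; first exact: implyP (rows_lt b c) lt_bc.
    exact: implyP (cols_lt b c) lt_bc.
case=> injQ rangeQ lt_before; split; first last.
- apply/'forall_forallP=> b c; apply/implyP=> lt_bc.
  by apply: lt_before; apply/orP; right.
- apply/'forall_forallP=> b c; apply/implyP=> lt_bc.
  by apply: lt_before; apply/orP; left.
have uniqQ : uniq (codom Q) by rewrite codomE map_inj_uniq ?enum_uniq.
have subQ : {subset codom Q <= iota 1 #|{: B}|}.
  by move=> k /codomP[b ->]; rewrite mem_iota add1n ltnS.
apply: uniq_perm; rewrite ?iota_uniq //.
by have [] := uniq_min_size uniqQ subQ; rewrite ?size_iota ?size_codom.
Qed.

Section Tableau.

Variable Q : std_tableau alpha.

Lemma entry_inj : injective Q.
Proof. by have /standardP[] := entryP Q. Qed.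

Lemma entry_range b : (0 < Q b <= #|{: B}|)%N.
Proof. by have /standardP[] := entryP Q. Qed.

Lemma entry_before b c : before b c -> (Q b < Q c)%N.
Proof. by have /standardP[_ _] := entryP Q; apply. Qed.

Lemma entry_box k : (0 < k <= #|{: B}|)%N -> exists b, Q b = k.
Proof.
have /and3P[/perm_mem permE _ _] := entryP Q => k_range.
have: k \in codom Q by rewrite permE mem_iota add1n ltnS.
by case/codomP=> b ->; exists b.
Qed.

Lemma sublevelS b k : Q b = k.+1 -> sublevel Q k.+1 = b |: sublevel Q k.
Proof.
move=> Qb; apply/setP=> c; rewrite !inE leq_eqVlt ltnS -Qb.
by rewrite (inj_eq entry_inj).
Qed.

Lemma sublevel_ex k : (k <= #|{: B}|)%N ->
  exists2 u, region u = sublevel Q k & #|region u| = k.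
Proof.
elim: k => [_|k IHk lt_k].
  exists \bot; rewrite region_bottom ?cards0 //.
  apply/setP=> b; rewrite !inE leqn0.
  by have /andP[] := entry_range b; case: (Q b).
have [u def_u rank_u] := IHk (ltnW lt_k).
have [b Qb] := @entry_box k.+1 lt_k.
have ub : b \notin region u by rewrite def_u inE Qb ltnn.
have [c /entry_before|v def_v] := region_add ub; first by rewrite def_u inE Qb.
by exists v; rewrite def_v ?cardsU1 ?ub ?rank_u // def_u -sublevelS.
Qed.

(** The element of rank [k] in the chain of [Q], for [k] at most the number of boxes; a
sublevel set is the region of some element because its boxes can be added in the
order of their entries. *)
Definition stage k : Y := odflt \bot [pick u | region u == sublevel Q k].

Lemma region_stage k : (k <= #|{: B}|)%N -> region (stage k) = sublevel Q k.
Proof.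
move=> /sublevel_ex[u def_u _]; rewrite /stage.
by case: pickP => [v /eqP //|/(_ u)]; rewrite def_u eqxx.
Qed.

Lemma rank_stage k : (k <= #|{: B}|)%N -> #|region (stage k)| = k.
Proof.
by move=> k_n; have [u def_u] := sublevel_ex k_n; rewrite region_stage // -def_u.
Qed.

Lemma stage_le k l : (k <= #|{: B}|)%N -> (l <= #|{: B}|)%N ->
  (stage k <= stage l) = (k <= l)%N.
Proof.
move=> k_n l_n; rewrite region_le; apply/idP/idP=> [/subset_leq_card|le_kl].
  by rewrite !rank_stage.
by rewrite !region_stage //; apply/subsetP=> b; rewrite !inE => /leq_trans; apply.
Qed.

(** The set of all stages, described without quantifying over [k]: the rank of an
element says which sublevel set to compare its region with. *)
Definition tableau_chain : {set Y} :=
  [set u | region u == sublevel Q #|region u|].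

Lemma stageK u : u \in tableau_chain -> stage #|region u| = u.
Proof.
by rewrite inE => /eqP def_u; apply: region_inj; rewrite region_stage ?max_card.
Qed.

Lemma stage_in k : (k <= #|{: B}|)%N -> stage k \in tableau_chain.
Proof. by move=> k_n; rewrite inE rank_stage // region_stage. Qed.

Lemma tableau_chain_chain : is_chain tableau_chain.
Proof.
apply/'forall_in_'forall_in_idP => u /stageK <- v /stageK <-.
by rewrite /Order.comparable !stage_le ?max_card // leq_total.
Qed.

(** The chain has a member of every rank, and comparable elements of the same rank
are equal. *)
Lemma tableau_chain_max : is_max_chain tableau_chain.
Proof.
apply/maxsetP; split=> [|c chc /subsetP sub_c]; first exact: tableau_chain_chain.
apply/eqP; rewrite eqEsubset; apply/andP; split; last exact/subsetP.
apply/subsetP=> u cu; have rank_u : (#|region u| <= #|{: B}|)%N := max_card _.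
have -> : u = stage #|region u|; last exact: stage_in.
apply: rank_inj; last by rewrite rank_stage.
exact: (chain_comparable chc cu (sub_c _ (stage_in rank_u))).
Qed.

Lemma along_tableau_chain (A : Type) (f : Y -> Y -> A) :
  along f tableau_chain = mkseq (fun k => f (stage k) (stage k.+1)) #|{: B}|.
Proof.
rewrite (@alongE _ _ _ f _ (stage 0) [seq stage k | k <- iota 1 #|{: B}|]).
- by rewrite /mkseq; elim: #|_| 0%N => //= n IHn k; rewrite IHn.
- suff: forall l k, (k + l <= #|{: B}|)%N ->
      path <%O (stage k) [seq stage i | i <- iota k.+1 l] by apply.
  elim=> //= l IHl k k_l; rewrite IHl ?addSnnS // andbT lt_neqAle stage_le; try lia.
  rewrite leqnSn andbT; apply: contraFneq (ltnn k) => eq_k.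
  by rewrite -(@stage_le k.+1 k) ?eq_k ?lexx; lia.
move=> u; apply/idP/idP=> [/stageK def_u | ].
  rewrite -[_ :: _]/[seq stage k | k <- iota 0 #|{: B}|.+1].
  by rewrite -def_u map_f // mem_iota ltnS max_card.
rewrite -[_ :: _]/[seq stage k | k <- iota 0 #|{: B}|.+1].
by case/mapP=> k; rewrite mem_iota ltnS => k_n ->; apply: stage_in.
Qed.

Lemma added_box_stage b k : Q b = k.+1 -> added_box (stage k) (stage k.+1) = Some b.
Proof.
move=> Qb; have /andP[_] := entry_range b; rewrite Qb => k_n.
by apply: added_boxE; rewrite !region_stage ?(sublevelS Qb) // ?inE ?Qb ?ltnn //; lia.
Qed.

(** The [k]-th added box (from 0) is the one with entry [k.+1], so it occurs in the
sequence of added boxes only at index [k]. *)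
Lemma tableau_chainK b :
  (index (Some b) (along (@added_box alpha) tableau_chain)).+1 = Q b.
Proof.
rewrite along_tableau_chain; set g := fun k => _.
have g_entry c k : Q c = k.+1 -> g k = Some c by exact: added_box_stage.
have /andP[] := entry_range b; case def_k: (Q b) => [//|k] _ k_n.
have uniq_g : uniq (mkseq g #|{: B}|).
  rewrite map_inj_in_uniq ?iota_uniq // => i j.
  rewrite !mem_iota => i_n j_n.
  have [c Qc] := @entry_box i.+1 i_n; have [e Qe] := @entry_box j.+1 j_n.
  rewrite (g_entry c) // (g_entry e) // => -[eq_ce].
  by apply/eqP; rewrite -eqSS -Qc -Qe eq_ce.
rewrite -(g_entry b k def_k) -(nth_mkseq (Some b) g k_n).
by rewrite index_uniq ?size_mkseq.
Qed.

End Tableau.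

(** * From maximal chains to standard tableaux *)

Lemma std_tableau_inj : injective (@entry alpha).
Proof.
case=> Q stdQ [Q' stdQ'] /= eqQ; subst Q'.
by rewrite (bool_irrelevance stdQ stdQ').
Qed.

Lemma max_chain_inj : injective (@chain_set _ Y).
Proof.
case=> m maxm [m' maxm'] /= eqm; subst m'.
by rewrite (bool_irrelevance maxm maxm').
Qed.

Section ChainTableau.

Variable m : max_chain Y.

Definition first_containing b : Y :=
  [arg min_(u < \top | (u \in chain_set m) && (b \in region u)) #|region u|]%N.

Lemma first_containingP b :
  [/\ first_containing b \in chain_set m, b \in region (first_containing b)
    & forall u, u \in chain_set m -> b \in region u -> first_containing b <= u].
Proof.
have chm := max_chain_chain (max_chainP m).
rewrite /first_containing; case: arg_minnP => [|u /andP[mu ub] min_u].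
  rewrite region_top inE andbT; apply: (max_chain_closed (max_chainP m)) => w _.
  by rewrite /Order.comparable lex1 orbT.
split=> // v mv vb; apply: rank_le; first exact: (chain_comparable chm).
by apply: min_u; rewrite mv.
Qed.

Definition rank_filling : {ffun B -> nat} :=
  [ffun b => #|region (first_containing b)|].

(** A box is in [u] as soon as its first element has rank at most that of [u], because
members of the chain are ordered by rank. *)
Lemma sublevel_rank u : u \in chain_set m ->
  region u = sublevel rank_filling #|region u|.
Proof.
move=> mu; apply/setP=> b; have [mb bb min_b] := first_containingP b.
rewrite [RHS]inE ffunE; apply/idP/idP=> [ub | le_u].
  by rewrite subset_leq_card // -region_le min_b.
have/rank_le-/(_ le_u) : first_containing b >=< u.
  exact: (chain_comparable (max_chain_chain (max_chainP m))).
by rewrite region_le => /subsetP; apply.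
Qed.

(** Injectivity carries the proof: two boxes with entry [k.+1] would both be added
between the members of ranks [k] and [k.+1]. *)
Lemma rank_filling_standard : is_standard rank_filling.
Proof.
have maxm := max_chainP m; have chm := max_chain_chain maxm.
have range_b b : (0 < rank_filling b <= #|{: B}|)%N.
  rewrite ffunE max_card andbT; apply/card_gt0P; exists b.
  by have [] := first_containingP b.
have inj : injective rank_filling.
  move=> b c eq_bc.
  have := range_b b; case def_k: (rank_filling b) => [//|k] /= k_n.
  have [v mv rank_v] := max_chain_rank maxm (ltnW k_n).
  have [w mw rank_w] := max_chain_rank maxm k_n.
  have sub_v := sublevel_rank mv; have sub_w := sublevel_rank mw.
  rewrite rank_v in sub_v; rewrite rank_w in sub_w.
  have sub_vw : region v \subset region w.
    by rewrite sub_v sub_w; apply/subsetP=> e; rewrite !inE => /leqW.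
  have: (#|region w :\: region v| <= 1)%N.
    by rewrite cardsD (setIidPr sub_vw) rank_v rank_w subSnn.
  move/card_le1_eqP; apply; rewrite sub_v sub_w !inE -?eq_bc def_k ltnn //=.
apply/standardP; split=> // b c lt_bc.
rewrite ltn_neqAle (inj_eq inj); apply/andP; split.
  by apply: contraTneq (before_lt lt_bc) => ->; rewrite ltnn.
have [mc cc _] := first_containingP c.
have := region_before lt_bc cc; rewrite (sublevel_rank mc) inE.
by rewrite [rank_filling c]ffunE.
Qed.

(** The chain of the rank filling contains [m], so it is [m] by maximality. *)
Lemma max_chain_tableau : exists Q, chain_set m = tableau_chain Q.
Proof.
exists (StdTableau rank_filling_standard); have [_ maxm] := maxsetP (max_chainP m).
apply/esym/maxm; first exact: tableau_chain_chain.
by apply/subsetP=> u mu; rewrite inE -sublevel_rank.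
Qed.

Lemma chain_tableau_standard : is_standard (chain_tableau m).
Proof.
have [Q def_m] := max_chain_tableau.
suff ->: chain_tableau m = Q by apply: entryP.
by apply/ffunP=> b; rewrite ffunE def_m tableau_chainK.
Qed.

End ChainTableau.

Definition tableau_of_chain (m : max_chain Y) := StdTableau (chain_tableau_standard m).
Definition chain_of_tableau Q := MaxChain (tableau_chain_max Q).

Lemma chain_of_tableauK : cancel chain_of_tableau tableau_of_chain.
Proof.
move=> Q; apply: std_tableau_inj; apply/ffunP=> b.
by rewrite ffunE tableau_chainK.
Qed.

Lemma tableau_of_chainK : cancel tableau_of_chain chain_of_tableau.
Proof.
move=> m; have [Q def_m] := max_chain_tableau m.
have -> : m = chain_of_tableau Q by apply: max_chain_inj.
by rewrite chain_of_tableauK.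
Qed.

(** * Tableau swaps seen on sublevel sets *)

Lemma swap_entry_self (Q : {ffun B -> nat}) i b :
  swap_entries i Q b = i -> Q b = i.+1.
Proof.
rewrite ffunE /=; case: eqVneq => [_ | ni]; first by move/eqP; rewrite gtn_eqF.
by case: eqVneq => // _ eq_i; rewrite eq_i eqxx in ni.
Qed.

Lemma swap_entry_succ (Q : {ffun B -> nat}) i b :
  swap_entries i Q b = i.+1 -> Q b = i.
Proof.
rewrite ffunE /=; case: eqVneq => // ni; case: eqVneq => [_ | ns].
  by move/eqP; rewrite ltn_eqF.
by move=> eq_s; rewrite eq_s eqxx in ns.
Qed.

Lemma swap_sublevel (Q Q' : {ffun B -> nat}) i j :
  Q' = swap_entries i Q -> j != i -> sublevel Q' j = sublevel Q j.
Proof.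
move=> -> nij; apply/setP=> b; rewrite !inE ffunE /=.
by case: eqP => [->|_]; [|case: eqP => [->|_]]; move: nij; lia.
Qed.

(** Away from [i] the sublevel sets determine the entries, except that they do not
separate [i] from [i.+1].  By injectivity, [Q] and [Q'] agree on both of the boxes
with these entries or on neither. *)
Lemma sublevel_swap (Q Q' : std_tableau alpha) i :
  (forall j, (j <= #|{: B}|)%N -> j != i -> sublevel Q' j = sublevel Q j) ->
  Q' <> Q -> entry Q' = swap_entries i Q.
Proof.
move=> eq_sub neqQ.
have le_sub b j : (j <= #|{: B}|)%N -> j != i -> (Q' b <= j)%N = (Q b <= j)%N.
  by move=> j_n /(eq_sub j j_n)/setP/(_ b); rewrite !inE.
have near b : Q' b = Q b \/ (Q b = i /\ Q' b = i.+1 \/ Q b = i.+1 /\ Q' b = i).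
  have := entry_range Q b; have := entry_range Q' b.
  (* If the two entries differ, every [j] from the smaller one up to just below the
     larger one tells them apart, so [i] is the only such [j]. *)
  have := le_sub b (Q b); have := le_sub b (Q b).-1.
  have := le_sub b (Q' b); have := le_sub b (Q' b).-1.
  by move: (Q b) (Q' b) #|_| => q q' n; lia.
have [b0 neq_b0] : exists b, Q' b != Q b.
  apply/existsP; apply: contra_notT neqQ; rewrite negb_exists => /forallP eqQ.
  by apply/std_tableau_inj/ffunP=> b; apply/eqP; rewrite -[_ == _]negbK.
apply/ffunP=> b; rewrite ffunE /=; have near_b := near b; have near_b0 := near b0.
have inj_b := inj_eq (@entry_inj Q) b b0; have inj_b' := inj_eq (@entry_inj Q') b b0.
have [eq_b | neq_b] := eqVneq b b0.
  move: near_b0 neq_b0; rewrite eq_b; move: (Q b0) (Q' b0) => q q'.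
  by case: (eqVneq q i) => /= ?; [|case: (eqVneq q i.+1) => /= ?]; lia.
rewrite (negbTE neq_b) in inj_b inj_b'.
move: near_b near_b0 neq_b0 inj_b inj_b'.
move: (Q b) (Q' b) (Q b0) (Q' b0) => q q' q0 q0'.
by case: (eqVneq q i) => /= ?; [|case: (eqVneq q i.+1) => /= ?]; lia.
Qed.

(** * Polygon moves are tableau swaps *)

Section Moves.

Variable T : std_tableau alpha.
Local Notation lab := (tableau_labeling T).

Lemma labelE u v b : b \notin region u -> region v = b |: region u -> lab u v = T b.
Proof. by move=> ub def_v; rewrite /tableau_labeling (added_boxE ub def_v). Qed.

(** With [k] the rank of [x], equality of the parts below [x] and above [z] says that
the chains agree at all ranks except [k.+1], where [y] shows that they differ. *)
Lemma polygon_move_swap Q Q' :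
  polygon_move lab (chain_of_tableau Q) (chain_of_tableau Q') -> swap_step T Q Q'.
Proof.
case=> x [z [[_ /setIP[mx m'x] /setIP[mz m'z]]]].
case=> low_eq [up_eq [[y [def_int + my] _]]].
case/and3P=> /coversP[c xc def_y] /coversP[b yb def_z].
rewrite (labelE xc def_y) (labelE yb def_z) leEnat -ltnNge => lt_bc.
have m'y : y \in tableau_chain Q'.
  have : y \in [set x; y; z] by rewrite !inE eqxx orbT.
  by rewrite -def_int => /setIP[].
set k := #|region x|; have rank_y : #|region y| = k.+1 by rewrite def_y cardsU1 xc.
have rank_z : #|region z| = k.+2 by rewrite def_z cardsU1 yb rank_y.
have z_n : (k.+2 <= #|{: B}|)%N by rewrite -rank_z max_card.
have sub_x : region x = sublevel Q' k by move: m'x; rewrite inE => /eqP.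
have sub_y : region y = sublevel Q' k.+1 by move: m'y; rewrite inE rank_y => /eqP.
have sub_z : region z = sublevel Q' k.+2 by move: m'z; rewrite inE rank_z => /eqP.
have Q'c : Q' c = k.+1.
  have : c \in region y by rewrite def_y setU11.
  move: xc; rewrite sub_x sub_y !inE -ltnNge => lt_k le_k.
  by apply/eqP; rewrite eqn_leq le_k.
have Q'b : Q' b = k.+2.
  have : b \in region z by rewrite def_z setU11.
  move: yb; rewrite sub_z sub_y !inE -ltnNge => lt_k le_k.
  by apply/eqP; rewrite eqn_leq le_k.
have eq_sub j : (j <= #|{: B}|)%N -> j != k.+1 -> sublevel Q' j = sublevel Q j.
  move=> j_n nj; suff m'j: stage Q j \in tableau_chain Q'.
    by rewrite -(region_stage Q j_n); move: m'j; rewrite inE rank_stage // => /eqP.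
  have [le_jk | lt_kj] := leqP j k.
    have : stage Q j \in lower_part (tableau_chain Q) x.
      by rewrite mem_lower_part stage_in //= -(stageK mx) stage_le // max_card.
    by rewrite low_eq mem_lower_part => /andP[].
  have : stage Q j \in upper_part (tableau_chain Q) z.
    rewrite mem_upper_part stage_in //= -(stageK mz) stage_le ?max_card // rank_z.
    by rewrite ltn_neqAle eq_sym nj.
  by rewrite up_eq mem_upper_part => /andP[].
have swapQ : entry Q' = swap_entries k.+1 Q.
  by apply: sublevel_swap eq_sub _ => eqQ; move: my; rewrite /= -eqQ m'y.
exists k.+1, b, c; split=> //.
  by move: Q'b; rewrite swapQ => /swap_entry_succ.
by move: Q'c; rewrite swapQ => /swap_entry_self.
Qed.

Lemma chain_interval Q k : (k.+2 <= #|{: B}|)%N ->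
  tableau_chain Q :&: interval_set (stage Q k) (stage Q k.+2)
    = [set stage Q k; stage Q k.+1; stage Q k.+2].
Proof.
move=> k_n; apply/setP=> u; rewrite !inE; apply/andP/idP=> [[mu] | ].
  have /stageK <- : u \in tableau_chain Q by rewrite inE.
  rewrite !stage_le ?max_card //; try lia; case/andP=> le_k.
  rewrite leq_eqVlt => /orP[/eqP->|]; first by rewrite eqxx orbT.
  rewrite ltnS leq_eqVlt => /orP[/eqP->|]; first by rewrite eqxx orbT.
  rewrite ltnS => le_k'; rewrite (_ : #|_| = k) ?eqxx //.
  by apply/eqP; rewrite eqn_leq le_k'.
rewrite -orbA => /or3P[] /eqP->;
  rewrite rank_stage ?region_stage // ?eqxx ?stage_le //; lia.
Qed.

(** An interval whose ends differ by two boxes has at most four elements. *)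
Lemma region_square x u b c : x <= u -> region u \subset c |: (b |: region x) ->
  [\/ region u = region x, region u = b |: region x,
      region u = c |: region x | region u = c |: (b |: region x)].
Proof.
rewrite region_le => /subsetP sub_xu /subsetP sub_u.
have mem_u e : (e \in region u) = [|| (e == c) && (c \in region u),
    (e == b) && (b \in region u) | e \in region x].
  apply/idP/idP=> [ue | ].
    have := sub_u e ue; rewrite in_setU1 in_setU1.
    by case/or3P=> [/eqP e_c|/eqP e_b|->]; rewrite -?e_c -?e_b ?ue ?eqxx ?orbT.
  by case/or3P=> [/andP[/eqP->]|/andP[/eqP->]|/sub_xu].
case uc: (c \in region u); case ub: (b \in region u);
  [apply: Or44 | apply: Or43 | apply: Or42 | apply: Or41];
  by apply/setP=> e; rewrite mem_u ?in_setU1 uc ub ?andbT ?andbF.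
Qed.

(** A maximal chain of [[x, z]] passes through exactly one of [y] and [y'], which are
incomparable; through [y] its labels are [T b, T c] and it ascends, through [y']
they are [T c, T b] and it descends. *)
Lemma square_polygon_move (m m' : max_chain Y) x y y' z b c :
    (T b < T c)%N -> b \notin region x -> c \notin region x ->
    region y = b |: region x -> region y' = c |: region x ->
    region z = c |: (b |: region x) ->
    chain_set m :&: interval_set x z = [set x; y; z] ->
    chain_set m' :&: interval_set x z = [set x; y'; z] ->
    lower_part (chain_set m) x = lower_part (chain_set m') x ->
    upper_part (chain_set m) z = upper_part (chain_set m') z ->
  polygon_move lab m m'.
Proof.
move=> lt_bc xb xc def_y def_y' def_z int_m int_m' low_eq up_eq.
have neq_bc : b != c by apply: contraTneq lt_bc => ->; rewrite ltnn.
have yc : c \notin region y by rewrite def_y in_setU1 negb_or eq_sym neq_bc.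
have y'b : b \notin region y' by rewrite def_y' in_setU1 negb_or neq_bc.
have def_zy : region z = c |: region y by rewrite def_y.
have def_zy' : region z = b |: region y' by rewrite def_y' def_z setUCA.
have cov_xy : covers x y by apply/coversP; exists b.
have cov_yz : covers y z by apply/coversP; exists c.
have cov_xy' : covers x y' by apply/coversP; exists c.
have cov_y'z : covers y' z by apply/coversP; exists b.
have lab_xy := labelE xb def_y; have lab_yz := labelE yc def_zy.
have lab_xy' := labelE xc def_y'; have lab_y'z := labelE y'b def_zy'.
have along3 w : covers x w -> covers w z ->
    along lab [set x; w; z] = [:: lab x w; lab w z].
  move=> /andP[lt_xw _] /andP[lt_wz _].
  rewrite (@alongE _ _ _ lab _ x [:: w; z]) //= ?lt_xw ?lt_wz //.
  by move=> t; rewrite !inE orbA.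
have incomp : y' >=< y = false.
  rewrite /Order.comparable !region_le def_y def_y' !subUset !sub1set !in_setU1.
  by rewrite (negbTE xb) (negbTE xc) (negbTE neq_bc) eq_sym (negbTE neq_bc).
have ends w (n : max_chain Y) : chain_set n :&: interval_set x z = [set x; w; z] ->
    x \in chain_set n /\ z \in chain_set n.
  move=> def_n; have: (x \in [set x; w; z]) && (z \in [set x; w; z]).
    by rewrite !inE !eqxx orbT.
  by rewrite -def_n => /andP[/setIP[-> _] /setIP[-> _]].
have [mx mz] := ends _ _ int_m; have [m'x m'z] := ends _ _ int_m'.
have my : y \in chain_set m.
  have : y \in [set x; y; z] by rewrite !inE eqxx orbT.
  by rewrite -int_m => /setIP[].
have max_y := max_chain_interval (max_chainP m) mx mz.
have max_y' := max_chain_interval (max_chainP m') m'x m'z.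
rewrite int_m in max_y; rewrite int_m' in max_y'.
exists x, z; split.
  split; try exact/setIP.
  by case/andP: cov_xy => /lt_trans + _; apply; case/andP: cov_yz.
do 2!split=> //; split.
  exists y'; split=> //; last first.
    apply: contraFN incomp => my'.
    exact: (chain_comparable (max_chain_chain (max_chainP m))).
  by rewrite /descent cov_xy' cov_y'z lab_xy' lab_y'z leEnat -ltnNge.
rewrite int_m; split=> //.
  by rewrite /ascending along3 //= lab_xy lab_yz andbT leEnat ltnW.
move=> s /maxsetP[/andP[chs /subsetP s_xz] max_s] asc_s.
have in4 u : u \in s -> [\/ u = x, u = y, u = y' | u = z].
  move=> su; have := s_xz u su; rewrite inE => /andP[xu].
  rewrite region_le def_z => /(region_square xu)[] eq_u;
    [apply: Or41 | apply: Or42 | apply: Or43 | apply: Or44];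
    by apply: region_inj; rewrite eq_u.
have [sy' | s'y'] := boolP (y' \in s); last first.
  apply/esym/max_s; first by have [] := maxsetP max_y.
  apply/subsetP=> u su; rewrite !inE.
  case: (in4 u su) => [-> | -> | def_u | ->]; rewrite ?eqxx ?orbT //.
  by rewrite -def_u su in s'y'.
have def_s : s = [set x; y'; z].
  apply/esym/max_s; first by have [] := maxsetP max_y'.
  apply/subsetP=> u su; rewrite !inE.
  case: (in4 u su) => [-> | def_u | -> | ->]; rewrite ?eqxx ?orbT //.
  by move: (chain_comparable chs sy' su); rewrite def_u incomp.
move: asc_s; rewrite def_s /ascending along3 //= lab_xy' lab_y'z.
by rewrite andbT leEnat leqNgt lt_bc.
Qed.

Lemma swap_polygon_move Q Q' :
  swap_step T Q Q' -> polygon_move lab (chain_of_tableau Q) (chain_of_tableau Q').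
Proof.
case=> -[[? [? [] //]]|k [b [c [/= k_n Qb Qc lt_bc swapQ]]]].
have Q'c : Q' c = k.+1 by rewrite swapQ ffunE /= Qc gtn_eqF ?eqxx.
have eq_sub j := swap_sublevel (j := j) swapQ.
have [k0_n k1_n] : (k <= #|{: B}| /\ k.+1 <= #|{: B}|)%N by split; lia.
have eq_stage j : (j <= #|{: B}|)%N -> j != k.+1 -> stage Q' j = stage Q j.
  by move=> j_n nj; apply: region_inj; rewrite !region_stage // eq_sub.
have eq_mem u : #|region u| != k.+1 ->
    (u \in tableau_chain Q) = (u \in tableau_chain Q').
  by move=> nu; rewrite !inE eq_sub.
have x' : stage Q' k = stage Q k by apply: eq_stage => //; rewrite ltn_eqF.
have z' : stage Q' k.+2 = stage Q k.+2 by apply: eq_stage => //; rewrite gtn_eqF.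
have def_x := region_stage Q k0_n.
apply: (@square_polygon_move _ _ (stage Q k) (stage Q k.+1) (stage Q' k.+1)
  (stage Q k.+2) b c) => //.
- by rewrite def_x inE Qb ltnn.
- by rewrite def_x inE Qc -ltnNge ltnW.
- by rewrite def_x region_stage // (sublevelS Qb).
- by rewrite -x' !region_stage // (sublevelS Q'c).
- by rewrite def_x region_stage // (sublevelS Qc) (sublevelS Qb).
- exact: chain_interval.
- by rewrite -x' -z'; exact: chain_interval.
- apply: lower_part_eq => u; rewrite region_le => /subset_leq_card.
  by rewrite rank_stage // => le_u; apply: eq_mem; rewrite neq_ltn ltnS le_u.
- apply: upper_part_eq => u; rewrite region_le => /subset_leq_card.
  by rewrite rank_stage // => le_u; apply: eq_mem; rewrite neq_ltn le_u orbT.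
Qed.

Lemma polygon_moveE m m' :
  polygon_move lab m m' <-> swap_step T (tableau_of_chain m) (tableau_of_chain m').
Proof.
rewrite -{1}(tableau_of_chainK m) -{1}(tableau_of_chainK m'); split.
  exact: polygon_move_swap.
exact: swap_polygon_move.
Qed.

(** * Closures and antisymmetry *)

Definition weight (Q : std_tableau alpha) := (\sum_b T b * Q b)%N.

(** Exchanging [i] at [b] and [i.+1] at [c] changes the weight by [T b - T c]. *)
Lemma weight_swap_step Q Q' : swap_step T Q Q' -> (weight Q' < weight Q)%N.
Proof.
case=> i [b [c [_ Qb Qc lt_bc swapQ]]].
have neq_cb : c != b by apply: contraTneq lt_bc => ->; rewrite ltnn.
rewrite /weight (bigD1 b) // (bigD1 c) //= [ltnRHS](bigD1 b) // (bigD1 c) //=.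
have -> : Q' b = i.+1 by rewrite swapQ ffunE /= Qb eqxx.
have -> : Q' c = i by rewrite swapQ ffunE /= Qc gtn_eqF ?eqxx.
rewrite Qb Qc (eq_bigr (fun e => T e * Q e)%N) => [|e /andP[ne_b ne_c]].
  by rewrite !addnA ltn_add2r; move: (T b) (T c) lt_bc => p q; lia.
rewrite swapQ ffunE /= -Qb (inj_eq (@entry_inj Q)) (negbTE ne_b) Qb -Qc.
by rewrite (inj_eq (@entry_inj Q)) (negbTE ne_c).
Qed.

Lemma weight_tableau_le Q Q' : tableau_le T Q Q' -> Q = Q' \/ (weight Q' < weight Q)%N.
Proof.
elim=> [Q1 Q2 /weight_swap_step|Q1|Q1 Q2 Q3 _ [-> //|lt12] _ [<-|lt23]]; auto.
by right; apply: ltn_trans lt12.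
Qed.

Lemma tableau_le_order : Relation_Definitions.order (std_tableau alpha) (tableau_le T).
Proof.
split; [exact: rt_refl | exact: rt_trans |].
move=> Q Q' /weight_tableau_le[-> //|lt1] /weight_tableau_le[-> //|lt2].
by have := ltn_trans lt1 lt2; rewrite ltnn.
Qed.

Lemma chain_descent_leE m m' :
  chain_descent_le lab m m' <-> tableau_le T (tableau_of_chain m) (tableau_of_chain m').
Proof.
split.
  elim=> [m1 m2 /polygon_moveE|m1|m1 m2 m3 _ + _]; first exact: rt_step.
    exact: rt_refl.
  exact: rt_trans.
rewrite -{2}(tableau_of_chainK m) -{2}(tableau_of_chainK m').
elim=> [Q1 Q2 step|Q1|Q1 Q2 Q3 _ + _].
- by apply/rt_step/polygon_moveE; rewrite !chain_of_tableauK.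
- exact: rt_refl.
- exact: rt_trans.
Qed.

End Moves.

End Regions.

Theorem theorem6p11 (alpha : skew_diagram) (T : std_tableau alpha) :
  exists f : max_chain (young_interval alpha) -> std_tableau alpha,
    (forall m, entry (f m) = chain_tableau m) /\
    poset_isomorphism (chain_descent_le (tableau_labeling T)) (tableau_le T) f.
Proof.
exists (@tableau_of_chain alpha); split=> //; split.
- have [_ _ le_antiT] := tableau_le_order T; split=> [m|m1 m2 m3|m m'].
  + exact: rt_refl.
  + exact: rt_trans.
  + move=> /chain_descent_leE le1 /chain_descent_leE le2.
    exact/(can_inj (@tableau_of_chainK alpha))/le_antiT.
- exact: tableau_le_order.
- exists (@chain_of_tableau alpha); first exact: tableau_of_chainK.
  exact: chain_of_tableauK.
- exact: chain_descent_leE.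
Qed.
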